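(* Let $d\ge 2$ be a fixed integer. For $R>0$ and $\theta>0$ let $\psi(R,\theta)$ denote the maximal number of lattice points (points of $\mathbb{Z}^d$) contained in $S$, the maximum being over all spherical segments $S\subseteq RS^{d-1}$ (of arbitrary direction) with opening angle $\theta$. Then \[\psi(R,\theta) \ll \kappa_d(R)\left(1+R\theta^{1/d}\right)\] as $\theta\to 0$ along with $R\to\infty$, uniformly in $R$ and $\theta$. That is, there exist constants $C,\theta_0,R_0>0$, depending only on $d$, such that $\psi(R,\theta)\le C\,\kappa_d(R)(1+R\theta^{1/d})$ for all $R\ge R_0$ and all $0<\theta\le\theta_0$.
   Context: $S^{d-1}$ is the unit sphere in $\mathbb{R}^d$ centred at the origin $O$, $RS^{d-1}$ the sphere of radius $R$, $|\cdot|$ the Euclidean norm, $\overline{B}(\alpha,r)$ the closed ball of radius $r$ about $\alpha$. Spherical cap: for $\beta\in\mathbb{R}^d$ with $|\beta|=1$ and a radius $r$ with $0\le r\le 2R$, the spherical cap of direction $\beta$ and radius $r$ is $T=RS^{d-1}\cap\overline{B}(R\beta,r)$. Its base is $RS^{d-1}\cap\{x:|x-R\beta|=r\}$, a $(d-2)$-sphere lying in a hyperplane orthogonal to $\beta$. Spherical segment: a set $S=T_1\setminus T_2$, where $T_1,T_2$ are spherical caps of the same direction $\beta$ and radii $r_1>r_2$; $\beta$ is called the direction of $S$. Opening angle: the opening angle of a cap is the angle $\angle POQ$, where $P,Q$ are antipodal points of its base; explicitly, a cap of radius $r_i$ has opening angle $\theta_i\in[0,2\pi]$ determined by $r_i=2R\sin(\theta_i/4)$.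 The opening angle of the segment $S=T_1\setminus T_2$ is $\theta=\theta_1-\theta_2$, where $\theta_i$ is the opening angle of $T_i$. $\kappa_d(R)$ is the maximal number of points of $\mathbb{Z}^d$ in the intersection of $RS^{d-1}$ with a rational hyperplane, i.e. a hyperplane that can be defined by an equation $a_1x_1+\dots+a_dx_d=a$ with integers $a_1,\dots,a_d$ (not all zero) and $a$. *)

(* Defs.v *)
From HB Require Import structures.
From mathcomp Require Import all_boot all_order all_algebra finmap.
From mathcomp Require Import all_classical all_reals all_analysis.

Set Implicit Arguments.
Unset Strict Implicit.
Unset Printing Implicit Defensive.

Import Order.TTheory GRing.Theory Num.Theory.
Import numFieldNormedType.Exports.

Local Open Scope classical_set_scope.
Local Open Scope ring_scope.

(* The library norm `|x| on 'rV[R]_d is the sup norm, hence this definition. *)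
Definition enorm (R : realType) (d : nat) (x : 'rV[R]_d) : R :=
  Num.sqrt (\sum_(i < d) x 0 i ^+ 2).

Definition sphere (R : realType) (d : nat) (rho : R) : set 'rV[R]_d :=
  [set x | enorm x = rho].

Definition closed_eball (R : realType) (d : nat) (a : 'rV[R]_d) (r : R) :
    set 'rV[R]_d :=
  [set x | enorm (x - a) <= r].

Definition lattice_points (R : realType) (d : nat) : set 'rV[R]_d :=
  [set x | forall i, x 0 i \is a Num.int].

(* fset_set sends an infinite set to fset0; the sets counted below are finite,
   see finite_sphere_lattice. *)
Definition lattice_count (R : realType) (d : nat) (A : set 'rV[R]_d) : nat :=
  #|` fset_set (A `&` @lattice_points R d)|%fset.

Definition is_greatest (A : set nat) (m : nat) : Prop :=
  A m /\ forall n, A n -> (n <= m)%N.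

(* The default value 0 is only reached when A is empty or unbounded. *)
Definition max_nat (A : set nat) : nat := xget 0%N (is_greatest A).

Definition spherical_cap (R : realType) (d : nat) (rho : R) (beta : 'rV[R]_d)
    (r : R) : set 'rV[R]_d :=
  @sphere R d rho `&` closed_eball (rho *: beta) r.

Definition cap_opening_angle (R : realType) (rho r theta : R) : Prop :=
  0 <= theta <= 2 * pi /\ r = 2 * rho * sin (theta / 4).

Definition is_spherical_segment (R : realType) (d : nat) (rho theta : R)
    (S : set 'rV[R]_d) : Prop :=
  exists (beta : 'rV[R]_d) (r1 r2 theta1 theta2 : R),
    [/\ enorm beta = 1,
        [/\ 0 <= r2, r2 < r1 & r1 <= 2 * rho],
        S = spherical_cap rho beta r1 `\` spherical_cap rho beta r2,
        cap_opening_angle rho r1 theta1 /\ cap_opening_angle rho r2 theta2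
      & theta = theta1 - theta2].

Definition rational_hyperplane (R : realType) (d : nat) (H : set 'rV[R]_d) :
    Prop :=
  exists (a : 'rV[int]_d) (b : int),
    a != 0 /\ H = [set x | \sum_(i < d) (a 0 i)%:~R * x 0 i = b%:~R].

Definition kappa (R : realType) (d : nat) (rho : R) : nat :=
  max_nat [set n | exists2 H : set 'rV[R]_d,
    rational_hyperplane H & n = lattice_count (@sphere R d rho `&` H)].

Definition psi (R : realType) (d : nat) (rho theta : R) : nat :=
  max_nat [set n | exists2 S : set 'rV[R]_d,
    is_spherical_segment rho theta S & n = lattice_count S].

Lemma finite_sphere_lattice (R : realType) (d : nat) (rho : R) :
  finite_set (@sphere R d rho `&` @lattice_points R d).
Proof.
pose N := Num.bound rho.
pose g (f : {ffun 'I_d -> 'I_(N + N).+1}) : 'rV[R]_d :=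
  \row_i ((f i : nat)%:R - N%:R).
apply: (@sub_finite_set _ _ (g @` setT)); last first.
  exact/finite_image/finite_finset.
move=> x [xr xZ].
have le_xN i : `|x 0 i| <= N%:R.
  have rho0 : 0 <= rho by rewrite -xr sqrtr_ge0.
  apply: (@le_trans _ _ rho); last first.
    by apply: ltW; apply: le_lt_trans (archi_boundP rho0).
  rewrite -xr -sqrtr_sqr ler_sqrt ?sumr_ge0 // => [|j _]; last exact: sqr_ge0.
  by rewrite (bigD1 i) //= lerDl sumr_ge0 // => j _; exact: sqr_ge0.
have /choice[h hE] i : exists k : 'I_(N + N).+1, (k : nat)%:R = x 0 i + N%:R.
  have := le_xN i; rewrite ler_norml => /andP[lo hi].
  have : x 0 i + N%:R \is a Num.nat.
    rewrite natrEint rpredD ?xZ ?intr_nat //=.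
    by rewrite -lerBlDr sub0r.
  case/natrP=> m mE.
  have mN : (m < (N + N).+1)%N.
    by rewrite ltnS -(ler_nat R) -mE natrD lerD2r.
  by exists (Ordinal mN).
exists (finfun h) => //; apply/rowP => i.
by rewrite mxE ffunE hE addrK.
Qed.

Lemma lattice_count_le (R : realType) (d : nat) (rho : R)
    (A : set 'rV[R]_d) : A `<=` @sphere R d rho ->
  (lattice_count A <= lattice_count (@sphere R d rho))%N.
Proof.
move=> AS; have fS := @finite_sphere_lattice R d rho.
have sub : A `&` @lattice_points R d `<=` @sphere R d rho `&` @lattice_points R d.
  by move=> x [/AS].
apply: fsubset_leq_card; rewrite -fset_set_sub //.
exact: sub_finite_set fS.
Qed.

Lemma max_natP (A : set nat) (b : nat) : A !=set0 ->
  (forall n, A n -> (n <= b)%N) -> is_greatest A (max_nat A).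
Proof.
move=> [n0 An0] Ab; apply: xgetPex.
have ex : exists n, `[< A n >] by exists n0; apply/asboolP.
have bd n : `[< A n >] -> (n <= b)%N by move/asboolP/Ab.
case: (ex_maxnP ex bd) => m /asboolP Am mmax.
by exists m; split => // n An; apply/mmax/asboolP.
Qed.

Lemma kappaP (R : realType) (d : nat) (rho : R) : (0 < d)%N ->
  is_greatest [set n | exists2 H : set 'rV[R]_d, rational_hyperplane H &
    n = lattice_count (@sphere R d rho `&` H)] (kappa d rho).
Proof.
case: d => // d _.
apply: (@max_natP _ (lattice_count (@sphere R d.+1 rho))).
  eexists; exists [set x : 'rV[R]_d.+1 |
    \sum_(i < d.+1) ((const_mx 1 : 'rV[int]_d.+1) 0 i)%:~R * x 0 i = 0%:~R] => //.
  exists (const_mx 1), 0; split => //.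
  by apply/eqP => /rowP/(_ 0); rewrite !mxE.
by move=> _ [H _ ->]; apply: lattice_count_le => x [].
Qed.

Lemma psiP (R : realType) (d : nat) (rho theta : R) : (0 < d)%N -> 0 < rho ->
  0 < theta <= 2 * pi ->
  is_greatest [set n | exists2 S : set 'rV[R]_d,
    is_spherical_segment rho theta S & n = lattice_count S] (psi d rho theta).
Proof.
case: d => // d _ rho0 /andP[t0 t2].
apply: (@max_natP _ (lattice_count (@sphere R d.+1 rho))); last first.
  by move=> _ [S [b [r1 [r2 [t1 [t3 [_ _ -> _ _]]]]]] ->];
    apply: lattice_count_le => x [[]].
eexists; eexists; last reflexivity.
exists (delta_mx 0 0), (2 * rho * sin (theta / 4)), 0, theta, 0.
have t4 : 0 < theta / 4 by rewrite divr_gt0.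
split => //; last by rewrite subr0.
- rewrite /enorm (bigD1 0) //= big1 => [|i /negPf i0]; rewrite !mxE ?i0 /=.
    by rewrite expr1n addr0 sqrtr1.
  by rewrite expr0n.
- split => //.
    rewrite !mulr_gt0 // sin_gt0_pi // t4 /= ltr_pdivrMr //.
    apply: le_lt_trans t2 _; rewrite mulrC ltr_pM2l ?pi_gt0 //.
    by rewrite ltr_nat.
  by rewrite ler_piMr ?sin_le1 // mulr_ge0 // ltW.
- split; split; rewrite ?lexx ?(ltW t0) ?t2 //.
    by rewrite mulr_ge0 // ltW // pi_gt0.
  by rewrite mul0r sin0 mulr0.
Qed.

(* Main.v *)
(** A segment of opening angle theta lies in a slab of width at most rho * theta
    orthogonal to its direction beta. By Dirichlet's theorem a multiple
    c * beta, with |c| of order theta ^ (1/d - 1), is within theta ^ (1/d) of an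
    integer vector p in every coordinate, so the linear form <p, x> varies by
    O(rho * theta ^ (1/d)) over the segment. At lattice points it is an integer,
    so they lie on 1 + O(rho * theta ^ (1/d)) rational hyperplanes. *)

Require Import Defs.
From HB Require Import structures.
From mathcomp Require Import all_boot all_order all_algebra finmap.
From mathcomp Require Import all_classical all_reals all_analysis.
From mathcomp Require Import ring lra.

Import Order.TTheory GRing.Theory Num.Theory.
Import numFieldNormedType.Exports.

Local Open Scope classical_set_scope.
Local Open Scope ring_scope.

(** * Simultaneous Diophantine approximation of a direction *)

(** Pigeonhole: the [N ^ n + 1] multiples [k * a], reduced modulo 1, fall into [N ^ n] boxes of side
    [1 / N]; two of them share a box, and [q] is the difference of their indices. *)
Lemma simultaneous_approximation (R : realType) (n N : nat) (a : 'I_n -> R) :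
  (0 < N)%N -> exists (q : nat) (p : 'I_n -> int),
    (0 < q <= N ^ n)%N /\
    forall i, `|(p i)%:~R - q%:R * a i| <= (N%:R : R)^-1.
Proof.
move=> N0; have N0R : 0 < N%:R :> R by rewrite ltr0n.
pose fr (x : R) := x - (Num.floor x)%:~R.
have fr_ge0 x : 0 <= fr x by rewrite subr_ge0 floor_le.
have fr_lt1 x : fr x < 1.
  by rewrite /fr; have /andP[_] := floor_itv x; rewrite intrD; lra.
have box_lt (k : nat) i : (Num.truncn (N%:R * fr (k%:R * a i))%R < N)%N.
  rewrite truncn_lt_nat; last by rewrite mulr_ge0 ?fr_ge0 ?ltW.
  by rewrite -[ltRHS]mulr1 ltr_pM2l.
pose box (k : 'I_(N ^ n).+1) : {ffun 'I_n -> 'I_N} :=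
  [ffun i => Ordinal (box_lt k i)].
have /injectivePn[k [l kl kl_box]] : ~~ injectiveb box.
  by apply/injectiveP => /leq_card; rewrite card_ffun !card_ord ltnn.
wlog lt_kl : k l kl kl_box / (k < l)%N.
  move=> wl; have := kl; rewrite -val_eqE neq_ltn => /orP[|lt]; first exact: wl.
  by apply: (wl l k) => //; rewrite eq_sym.
exists (l - k)%N, (fun i => Num.floor (l%:R * a i) - Num.floor (k%:R * a i)).
split.
  by rewrite subn_gt0 lt_kl (leq_trans (leq_subr _ _)) // -ltnS ltn_ord.
move=> i.
have /(congr1 val) /= := congr1 (fun f : {ffun 'I_n -> 'I_N} => f i) kl_box.
rewrite !ffunE /= => eq_trunc.
(* Both scaled fractional parts lie in the same unit interval, so they differ by less than 1. *)
have tk := truncn_itv (mulr_ge0 (ltW N0R) (fr_ge0 (k%:R * a i))).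
have tl := truncn_itv (mulr_ge0 (ltW N0R) (fr_ge0 (l%:R * a i))).
rewrite eq_trunc in tk.
rewrite -[leRHS]mul1r ler_pdivlMr // -[X in _ * X]gtr0_norm // -normrM.
rewrite natrB; last exact: ltnW.
rewrite intrD rmorphN /= ler_norml; move: tk tl; rewrite /fr -natr1.
by move=> /andP[? ?] /andP[? ?]; apply/andP; split; lra.
Qed.

(** The largest square is at least the average [1 / n.+1]; the weaker bound stated keeps square
    roots out of the constants. *)
Lemma max_coord_ge (R : realType) (n : nat) (beta : 'rV[R]_n.+1) :
  enorm beta = 1 -> exists j, 1 <= n.+1%:R * `|beta 0 j|.
Proof.
move=> beta1.
have sum1 : \sum_(i < n.+1) beta 0 i ^+ 2 = 1.
  rewrite -[LHS]sqr_sqrtr; last by apply: sumr_ge0 => i _; exact: sqr_ge0.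
  by move: beta1; rewrite /enorm => ->; rewrite expr1n.
have [j _ jmax] := @arg_maxP _ R _ ord0 xpredT (fun i => `|beta 0 i|) isT.
exists j; have n1 : 1 <= n.+1%:R :> R by rewrite ler1n.
have : 1 <= n.+1%:R * `|beta 0 j| ^+ 2.
  rewrite -[leLHS]sum1; have -> : n.+1%:R * `|beta 0 j| ^+ 2 =
      \sum_(i < n.+1) `|beta 0 j| ^+ 2 by rewrite sumr_const card_ord mulr_natl.
  apply: ler_sum => i _; rewrite -[leLHS]real_normK ?num_real //.
  by rewrite lerXn2r ?nnegrE //; exact: jmax.
rewrite expr2 mulrA => h; rewrite leNgt; apply/negP => lt1.
have b0 := normr_ge0 (beta 0 j).
have : `|beta 0 j| < 1 by nra.
by nra.
Qed.

(* Dividing by a large coordinate turns one coordinate into 1, so only the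
   other n need approximating: this is what makes the exponent of theta equal
   to 1/d rather than 1/(d+1). *)
Lemma integer_normal (R : realType) (n N : nat) (beta : 'rV[R]_n.+1) :
  (0 < N)%N -> enorm beta = 1 ->
  exists (p : 'rV[int]_n.+1) (c : R),
    [/\ p != 0, `|c| <= (N ^ n)%:R * n.+1%:R &
      forall i, `|(p 0 i)%:~R - c * beta 0 i| <= (N%:R : R)^-1].
Proof.
move=> N0 /max_coord_ge[j jbig].
have bj0 : beta 0 j != 0.
  by apply/eqP => b0; move: jbig; rewrite b0 normr0 mulr0 ler10.
have [q [p [/andP[q0 qN] pP]]] :=
  @simultaneous_approximation R n N (fun i => beta 0 (lift j i) / beta 0 j) N0.
(* Taking [c = q / beta_j] makes coordinate [j] exact: there [p] equals [q > 0], which also gives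
   [p != 0]. *)
exists (\row_i if unlift j i is Some k then p k else q%:Z), (q%:R / beta 0 j).
split.
- apply/eqP => /rowP/(_ j); rewrite !mxE unlift_none => /eqP.
  by rewrite eqz_nat => /eqP q00; rewrite q00 in q0.
- rewrite normrM normfV ger0_norm // ler_pdivrMr ?normr_gt0 // -mulrA.
  by rewrite -[leLHS]mulr1 ler_pM ?ler0n // ler_nat.
- move=> i; rewrite mxE; case: unliftP => [k ->|->].
    by rewrite -mulrA [_^-1 * _]mulrC.
  by rewrite divfK // subrr normr0 invr_ge0.
Qed.

(** * Counting lattice points by hyperplanes *)

Lemma lattice_count_cover (R : realType) (d : nat) (rho : R) (m : nat)
    (H : nat -> set 'rV[R]_d) (A : set 'rV[R]_d) :
  A `<=` sphere rho ->
  (forall x, A x -> lattice_points x -> exists2 k, (k < m)%N & H k x) ->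
  (lattice_count A <= \sum_(k < m) lattice_count (sphere rho `&` H k))%N.
Proof.
elim: m A => [|m IHm] A AS cover.
  rewrite big_ord0 leqn0 /lattice_count cardfs_eq0.
  suff -> : A `&` @lattice_points R d = set0 by rewrite fset_set0.
  by rewrite -subset0 => x [Ax xZ]; have [] := cover x Ax xZ.
(* Finiteness keeps [fset_set] away from its default value, the empty set. *)
have fin B : B `<=` sphere rho -> finite_set (B `&` @lattice_points R d).
  move=> BS; apply: sub_finite_set (@finite_sphere_lattice R d rho).
  by move=> x [/BS].
rewrite big_ord_recr /=; set Sm := sphere rho `&` H m.
have SmS : Sm `<=` sphere rho by move=> x [].
have ADS : A `\` H m `<=` sphere rho by move=> x [/AS].
apply: (@leq_trans (lattice_count (A `\` H m) + lattice_count Sm)).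
  rewrite /lattice_count -cardfsUI -fset_setU; try exact: fin.
  apply: leq_trans (leq_addr _ _); apply: fsubset_leq_card.
  rewrite -fset_set_sub; [|exact: fin|by rewrite finite_setU; split; exact: fin].
  by move=> x [Ax xZ]; case: (pselect (H m x)) => Hx;
    [right; split=> //; split=> //; exact: AS|left].
rewrite leq_add2r; apply: IHm => // x [Ax nHx] xZ.
have [k] := cover x Ax xZ.
rewrite ltnS leq_eqVlt => /orP[/eqP->//|km] Hk.
by exists k.
Qed.

(** An integral form takes integer values at lattice points, and an interval of length [2 * W]
    contains at most [1 + 2 * W] integers; each value cuts out one rational hyperplane. *)
Lemma lattice_count_slab (R : realType) (n : nat) (rho c W : R)
    (p : 'rV[int]_n.+1) (A : set 'rV[R]_n.+1) :
  p != 0 -> 0 <= W -> A `<=` sphere rho ->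
  (forall x, A x -> `|\sum_(i < n.+1) (p 0 i)%:~R * x 0 i - c| <= W) ->
  (lattice_count A)%:R <= (kappa n.+1 rho)%:R * (1 + 2 * W).
Proof.
move=> p0 W0 AS slab.
(* The least admissible integer value, and a bound for the number of such values. *)
set m := Num.ceil (c - W); set K := (Num.truncn (2 * W)).+1.
pose H (k : nat) := [set x : 'rV[R]_n.+1 |
  \sum_(i < n.+1) (p 0 i)%:~R * x 0 i = (m + k%:Z)%:~R].
have cover x : A x -> lattice_points x -> exists2 k, (k < K)%N & H k x.
  move=> /slab + xZ; set s := \sum_(i < _) _; rewrite ler_norml => /andP[lo hi].
  have /intrP[z zE] : s \is a Num.int.
    by apply: rpred_sum => i _; rewrite rpredM ?intr_int ?xZ.
  have mz : m <= z by rewrite ceil_le_int -zE; lra.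
  have zm : (`|z - m|%N)%:Z = z - m by rewrite gez0_abs // subr_ge0.
  exists `|z - m|%N; last by rewrite /H /= -/s zE zm addrC subrK.
  rewrite ltnS truncn_ge_nat; last by rewrite mulr_ge0.
  rewrite -[X in X <= _]/((`|z - m|%N)%:Z%:~R) zm intrB -zE.
  have := ceil_ge (c - W); rewrite -/m; lra.
have KW : K%:R <= 1 + 2 * W.
  by rewrite /K -natr1 addrC lerD2l truncn_le // mulr_ge0.
have : (lattice_count A <= K * kappa n.+1 rho)%N.
  apply: leq_trans (lattice_count_cover _ _ _ _ _ _ AS cover) _.
  have -> : (K * kappa n.+1 rho = \sum_(k < K) kappa n.+1 rho)%N.
    by rewrite sum_nat_const card_ord.
  apply: leq_sum => k _.
  have [_] := @kappaP R n.+1 rho isT; apply.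
  by exists (H k) => //; exists p, (m + (k : nat)%:Z).
rewrite -(ler_nat R) natrM mulrC => /le_trans; apply.
by rewrite ler_wpM2l.
Qed.

(** * Spherical segments as parts of slabs *)

Lemma norm_coord_le_enorm (R : realType) (d : nat) (x : 'rV[R]_d) i :
  `|x 0 i| <= enorm x.
Proof.
rewrite -sqrtr_sqr ler_sqrt ?sumr_ge0 // => [|j _]; last exact: sqr_ge0.
by rewrite (bigD1 i) //= lerDl sumr_ge0 // => j _; exact: sqr_ge0.
Qed.

Lemma sin_sub_le (R : realType) (a b : R) : a <= b -> sin b - sin a <= b - a.
Proof.
move=> ab.
have [c _ ->] := @MVT_segment R sin cos a b ab
  (fun x _ => is_derive_sin x) (continuous_subspaceT (@continuous_sin R)).
by rewrite -[leRHS]mul1r ler_wpM2r ?subr_ge0 // cos_le1.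
Qed.

(** On the sphere the distance to the cap centre depends only on the inner product with [beta], so
    bounds on that distance become bounds on a linear form. *)
Lemma enorm_sub_sqr (R : realType) (d : nat) (rho : R) (x beta : 'rV[R]_d) :
  enorm beta = 1 -> enorm x = rho ->
  enorm (x - rho *: beta) ^+ 2 =
    2 * rho ^+ 2 - 2 * rho * \sum_(i < d) beta 0 i * x 0 i.
Proof.
have E (y : 'rV[R]_d) : enorm y ^+ 2 = \sum_(i < d) y 0 i ^+ 2.
  by rewrite sqr_sqrtr // sumr_ge0 // => i _; exact: sqr_ge0.
move=> /(congr1 (fun u => u ^+ 2)); rewrite E expr1n => b1.
move=> /(congr1 (fun u => u ^+ 2)); rewrite E => xr.
rewrite E (eq_bigr (fun i => x 0 i ^+ 2 + (rho ^+ 2 * beta 0 i ^+ 2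
   - 2 * rho * (beta 0 i * x 0 i)))); last by move=> i _; rewrite !mxE; ring.
by rewrite big_split /= sumrB -!mulr_sumr xr b1; ring.
Qed.

(** The slab has width [(r1 ^+ 2 - r2 ^+ 2) / (2 * rho)], where [r1 - r2 <= rho * theta / 2] and
    [r1 + r2 <= 4 * rho]. *)
Lemma segment_sub_slab (R : realType) (d : nat) (rho theta : R)
    (S : set 'rV[R]_d) :
  0 < rho -> 0 < theta -> is_spherical_segment rho theta S ->
  exists (beta : 'rV[R]_d) (lo : R), [/\ enorm beta = 1, S `<=` sphere rho &
    forall x, S x ->
      lo <= \sum_(i < d) beta 0 i * x 0 i <= lo + rho * theta].
Proof.
move=> rho0 theta0 [beta [r1 [r2 [t1 [t2 [b1 [r20 r21 r1le] -> [[_ r1E] [_ r2E]] thE]]]]]].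
(* The value of the form at distance exactly [r1], on the base of the larger cap. *)
exists beta, ((2 * rho ^+ 2 - r1 ^+ 2) / (2 * rho)); split => //.
  by move=> x [[]].
move=> x [[xr]]; rewrite /spherical_cap /closed_eball /= => xr1 nx.
have := enorm_sub_sqr _ _ _ _ _ b1 xr; set u := \sum_(i < d) _ => eu.
have xr2 : r2 < enorm (x - rho *: beta).
  by rewrite ltNge; apply/negP => h; apply: nx.
have sin_diff : sin (t1 / 4) - sin (t2 / 4) <= theta / 4.
  by apply: le_trans (sin_sub_le _ _ _ _) _; rewrite thE in theta0 *; lra.
have r_diff : r1 - r2 <= rho * theta / 2 by rewrite r1E r2E; nra.
have sq_diff : r1 ^+ 2 - r2 ^+ 2 <= rho * theta / 2 * (4 * rho).
  by rewrite subr_sqr ler_pM //; lra.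
have sq1 : enorm (x - rho *: beta) ^+ 2 <= r1 ^+ 2.
  by rewrite lerXn2r // nnegrE; [exact: sqrtr_ge0|exact: ltW (le_lt_trans r20 r21)].
have sq2 : r2 ^+ 2 <= enorm (x - rho *: beta) ^+ 2.
  by rewrite lerXn2r // ?nnegrE ?sqrtr_ge0 // ltW.
have rho2 : 0 < 2 * rho by rewrite mulr_gt0.
rewrite -lerBlDr ler_pdivrMr // ler_pdivlMr //.
rewrite eu in sq1 sq2; apply/andP; split; first by lra.
by rewrite -subr_ge0; nra.
Qed.

(** * Choice of the scale and conclusion *)

(** Balances the approximation error [1 / N] against [N ^ n * theta], which bounds the effect of the
    slab width: with [N] about [1 / s] both are of order [s]. *)
Lemma scale_parameter (R : realType) (n : nat) (theta : R) :
  0 < theta -> theta <= 1 ->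
  let s := theta `^ (n.+1%:R)^-1 in
  exists N : nat, [/\ (0 < N)%N, (N%:R : R)^-1 <= s &
    (N ^ n)%:R * theta <= (2 ^ n)%:R * s].
Proof.
move=> t0 t1 s; have s0 : 0 < s by rewrite powR_gt0.
have sX : s ^+ n.+1 = theta.
  rewrite /s -powR_mulrn ?powR_ge0 // -powRrM mulVf ?pnatr_eq0 //.
  by rewrite powRr1 // ltW.
have s1 : s <= 1.
  rewrite leNgt; apply/negP => lt1; move: t1; rewrite -sX leNgt.
  by rewrite exprn_egt1.
exists (Num.truncn s^-1).+1; split=> //.
  by rewrite invf_ple ?posrE // ?ltr0n // ltW // truncnS_gt.
(* Cancelling one factor [s] leaves [(N * s) ^ n <= 2 ^ n]; and [N <= 1 / s + 1 <= 2 / s] because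
   [s <= 1]. *)
rewrite -sX exprS mulrCA [leRHS]mulrC ler_pM2l // !natrX -exprMn.
rewrite lerXn2r ?nnegrE ?mulr_ge0 ?(ltW s0) //.
rewrite -ler_pdivlMr //; apply: (@le_trans _ _ (s^-1 + 1)).
  by rewrite -natr1 lerD2r truncn_le // invr_ge0 ltW.
have : 1 <= s^-1 by rewrite invr_ge1 ?unitfE ?gt_eqF.
by lra.
Qed.

Theorem theorem1p3 (R : realType) (d : nat) (hd : (2 <= d)%N) :
  exists C theta0 R0 : R, [/\ 0 < C, 0 < theta0, 0 < R0 &
    forall rho theta : R, R0 <= rho -> 0 < theta -> theta <= theta0 ->
      (psi d rho theta)%:R <=
        C * (kappa d rho)%:R * (1 + rho * theta `^ (d%:R)^-1)].
Proof.
case: d hd => // n _.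
pose D : R := n.+1%:R.
(* The first constant is read off from [1 + 2 * W] below; [theta <= 1] gives [s <= 1] and
   [theta <= 2 * pi]. *)
exists (1 + 2 * D * ((2 ^ n)%:R + 1)), 1, 1.
have D0 : 0 <= D by rewrite ler0n.
have pow0 : 0 <= (2 ^ n)%:R :> R by rewrite ler0n.
have C1 : 0 <= 2 * D * ((2 ^ n)%:R + 1) by rewrite !mulr_ge0 // addr_ge0.
split=> // [|rho theta rho1 t0 t1]; first by lra.
have rho0 : 0 < rho by lra.
have t2pi : 0 < theta <= 2 * pi.
  by rewrite t0 (le_trans t1) //; have := pi_ge2 R; lra.
(* The maximum [psi] is attained, so it suffices to bound the count for one segment [S]. *)
have [[S /(segment_sub_slab _ _ _ _ _ rho0 t0)[beta [lo [b1 AS slab]]] ->] _] :=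
  @psiP R n.+1 rho theta isT rho0 t2pi.
have [N [N0 Ns Nt]] := scale_parameter _ n _ t0 t1.
set s := theta `^ _ in Ns Nt *.
have s0 : 0 <= s by exact: powR_ge0.
have [p [c [p0 cle pP]]] := integer_normal _ _ _ _ N0 b1.
pose W := D * ((2 ^ n)%:R + 1) * (rho * s).
have W0 : 0 <= W by rewrite !mulr_ge0 ?addr_ge0 // ltW.
have near x : S x -> `|\sum_(i < n.+1) (p 0 i)%:~R * x 0 i - c * lo| <= W.
  move=> Sx; have /andP[lo_u u_hi] := slab x Sx.
  set u := \sum_(i < _) _ in lo_u u_hi.
  (* Splits the deviation into the error of replacing [c * beta] by [p] and [c] times the position
     inside the slab. *)
  have -> : \sum_(i < n.+1) (p 0 i)%:~R * x 0 i - c * lo =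
      \sum_(i < n.+1) ((p 0 i)%:~R - c * beta 0 i) * x 0 i + c * (u - lo).
    rewrite mulrBr addrA; congr (_ - _); rewrite mulr_sumr -big_split /=.
    by apply: eq_bigr => i _; ring.
  apply: (@le_trans _ _ (D * (s * rho) + (N ^ n)%:R * D * (rho * theta))).
    apply: le_trans (ler_normD _ _) (lerD _ _).
      apply: le_trans (ler_norm_sum _ _ _) _.
      have -> : D * (s * rho) = \sum_(i < n.+1) s * rho.
        by rewrite sumr_const card_ord mulr_natl.
      apply: ler_sum => i _; rewrite normrM ler_pM //.
        exact: le_trans (pP i) Ns.
      by rewrite -(AS x Sx) norm_coord_le_enorm.
    by rewrite normrM ler_pM // ger0_norm; lra.
  have -> : W = D * (s * rho) + D * rho * ((2 ^ n)%:R * s) by rewrite /W; ring.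
  rewrite lerD2l [leLHS](_ : _ = D * rho * ((N ^ n)%:R * theta)); last by ring.
  by rewrite ler_wpM2l // mulr_ge0 // ltW.
apply: le_trans (lattice_count_slab _ _ _ _ _ _ _ p0 W0 AS near) _.
rewrite -[leRHS]mulrA [leRHS]mulrCA ler_wpM2l //.
have rs0 : 0 <= rho * s by rewrite mulr_ge0 // ltW.
by rewrite /W; lra.
Qed.
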